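(* There is a natural isomorphism of categories from reflexive diffeological spaces (with diffeologically smooth maps) to reflexive differential spaces (with functionally smooth maps).
   Context: Diffeology. A parametrisation of a nonempty set $X$ is a function $p:U\to X$ with $U$ an open subset of some $\mathbb{R}^n$. A diffeology $\mathcal{D}$ on $X$ is a set of parametrisations (called plots) such that: (1) for every $x\in X$ and every integer $n\ge 0$ the constant map $\mathbb{R}^n\to\{x\}\subseteq X$ is in $\mathcal{D}$; (2) if $p:U\to X$ is a parametrisation such that every $u\in U$ has an open neighbourhood $V\subseteq U$ with $p|_V\in\mathcal{D}$, then $p\in\mathcal{D}$; (3) if $(p:U\to X)\in\mathcal{D}$, $V\subseteq\mathbb{R}^n$ is open (any $n$) and $F:V\to U$ is smooth, then $p\circ F\in\mathcal{D}$. The pair $(X,\mathcal{D})$ is called a diffeological space. A map $F:(X,\mathcal{D}_X)\to(Y,\mathcal{D}_Y)$ is diffeologically smooth if $F\circ p\in\mathcal{D}_Y$ for all $p\in\mathcal{D}_X$. Differential structure. A differential structure on a nonempty set $X$ is a nonempty family $\mathcal{F}$ of functions $X\to\mathbb{R}$, together with the weakest topology on $X$ making every element of $\mathcal{F}$ continuous, such that: (1) for every positive integer $k$, $f_1,\dots,f_k\in\mathcal{F}$ and $F\in C^\infty(\mathbb{R}^k)$, $F(f_1,\dots,f_k)\in\mathcal{F}$; (2) if $f:X\to\mathbb{R}$ is such that every $x\in X$ has an open neighbourhood $U$ and some $g\in\mathcal{F}$ with $f|_U=g|_U$, then $f\in\mathcal{F}$. The pair $(X,\mathcal{F})$ is called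 a differential space. A map $F:(X,\mathcal{F}_X)\to(Y,\mathcal{F}_Y)$ is functionally smooth if $f\circ F\in\mathcal{F}_X$ for all $f\in\mathcal{F}_Y$. Reflexivity. For a set $\mathcal{D}_0$ of parametrisations into $X$ let $\Phi\mathcal{D}_0=\{f:X\to\mathbb{R}\mid f\circ p\in C^\infty(U)\ \forall (p:U\to X)\in\mathcal{D}_0\}$. For a set $\mathcal{F}_0$ of functions $X\to\mathbb{R}$ let $\Pi\mathcal{F}_0=\{\text{parametrisations }p:U\to X\mid f\circ p\in C^\infty(U)\ \forall f\in\mathcal{F}_0\}$. A diffeology $\mathcal{D}$ is reflexive if $\Pi\Phi\mathcal{D}=\mathcal{D}$; a differential structure $\mathcal{F}$ is reflexive if $\Phi\Pi\mathcal{F}=\mathcal{F}$. Reflexive diffeological spaces form a full subcategory of diffeological spaces, and reflexive differential spaces form a full subcategory of differential spaces. *)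

(* Defs.v *)
From HB Require Import structures.
From mathcomp Require Import all_boot all_order all_algebra.
From mathcomp Require Import mathcomp_extra boolp classical_sets functions.
From mathcomp Require Import reals topology normedtype derive.

Set Implicit Arguments.
Unset Strict Implicit.
Unset Printing Implicit Defensive.

Import GRing.Theory Num.Theory.
Import numFieldNormedType.Exports.

Local Open Scope classical_set_scope.
Local Open Scope ring_scope.

(* The function [f] is total, but for open [U] these predicates only depend on
   its restriction to [U].  The partial derivatives are the entries of the
   Jacobian, so [Ck k.+1] says that [f] is differentiable on [U] with a
   derivative of class C^k. *)
Fixpoint Ck (R : realType) (n : nat) (W : normedModType R) (k : nat)
    (U : set 'rV[R]_n) (f : 'rV[R]_n -> W) : Prop :=
  match k with
  | 0 => forall x, U x -> {for x, continuous f}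
  | k'.+1 => (forall x, U x -> differentiable f x) /\
             (forall i : 'I_n, Ck k' U ('D_(delta_mx 0 i) f))
  end.

Definition smooth_on (R : realType) (n : nat) (W : normedModType R)
    (U : set 'rV[R]_n) (f : 'rV[R]_n -> W) : Prop :=
  forall k, Ck k U f.

(* [valL_ 0 g] extends [g] by 0 outside [U], which is harmless as [U] is
   always open below. *)
Definition smooth (R : realType) (n : nat) (W : normedModType R)
    (U : set 'rV[R]_n) (g : U -> W) : Prop :=
  smooth_on U (valL_ 0 g).

Record parametrization (R : realType) (X : Type) := Parametrization {
  pdim : nat;
  pdom : set 'rV[R]_pdim;
  pdom_open : open pdom;
  pfun : pdom -> X
}.
Arguments pdom {R X} p.
Arguments pdom_open {R X} p.
Arguments pfun {R X} p.

Definition subset_incl (T : Type) (V U : set T) (VU : V `<=` U) (v : V) : U :=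
  exist _ (val v) (mem_set (VU _ (set_mem (valP v)))).

Definition const_param (R : realType) (X : Type) (n : nat) (x : X) :
    parametrization R X :=
  @Parametrization R X n setT openT (fun=> x).

Definition restrict_param (R : realType) (X : Type) (p : parametrization R X)
    (V : set 'rV[R]_(pdim p)) (oV : open V) (VU : V `<=` pdom p) :
    parametrization R X :=
  Parametrization oV (pfun p \o subset_incl VU).

Definition precomp_param (R : realType) (X : Type) (p : parametrization R X)
    (n : nat) (V : set 'rV[R]_n) (oV : open V) (F : V -> pdom p) :
    parametrization R X :=
  Parametrization oV (pfun p \o F).

Definition postcomp_param (R : realType) (X Y : Type) (h : X -> Y)
    (p : parametrization R X) : parametrization R Y :=
  Parametrization (pdom_open p) (h \o pfun p).

Record is_diffeology (R : realType) (X : Type)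
    (D : set (parametrization R X)) : Prop := IsDiffeology {
  diffeology_nonempty : inhabited X;
  diffeology_const : forall (x : X) (n : nat), D (const_param R n x);
  diffeology_local : forall p : parametrization R X,
    (forall u, pdom p u ->
       exists (V : set 'rV[R]_(pdim p)) (oV : open V) (VU : V `<=` pdom p),
         V u /\ D (restrict_param oV VU)) ->
    D p;
  diffeology_precomp : forall (p : parametrization R X) (n : nat)
    (V : set 'rV[R]_n) (oV : open V) (F : V -> pdom p),
    D p -> smooth (fun v => val (F v)) -> D (precomp_param oV F)
}.

Record diffeologicalSpace (R : realType) := DiffeologicalSpace {
  dcarrier : Type;
  plots : set (parametrization R dcarrier);
  plots_diffeology : is_diffeology plots
}.

Arguments plots {R} d.

Definition diffeologically_smooth (R : realType) (X Y : diffeologicalSpace R)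
    (h : dcarrier X -> dcarrier Y) : Prop :=
  forall p, plots X p -> plots Y (postcomp_param h p).

Definition is_topology (X : Type) (T : set (set X)) : Prop :=
  [/\ T setT,
      forall A B, T A -> T B -> T (A `&` B) &
      forall S : set (set X), S `<=` T -> T (\bigcup_(A in S) A)].

(* The open sets of the weakest topology on X making every element of [F]
   continuous. *)
Definition functional_open (R : realType) (X : Type) (F : set (X -> R)) :
    set (set X) :=
  smallest (@is_topology X)
    [set A | exists f, exists V : set R, [/\ F f, open V & A = f @^-1` V]].

Record is_differential_structure (R : realType) (X : Type)
    (F : set (X -> R)) : Prop := IsDifferentialStructure {
  diffstruct_nonempty : inhabited X;
  diffstruct_family_nonempty : F !=set0;
  diffstruct_comp : forall (k : nat) (f : 'I_k -> X -> R) (G : 'rV[R]_k -> R),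
    (0 < k)%N -> (forall i, F (f i)) -> smooth_on setT G ->
    F (fun x => G (\row_i f i x));
  diffstruct_local : forall f : X -> R,
    (forall x, exists2 U, functional_open F U &
       U x /\ exists2 g, F g & forall y, U y -> f y = g y) ->
    F f
}.

Record differentialSpace (R : realType) := DifferentialSpace {
  fcarrier : Type;
  structure_functions : set (fcarrier -> R);
  functions_structure : is_differential_structure structure_functions
}.

Arguments structure_functions {R} d.

Definition functionally_smooth (R : realType) (X Y : differentialSpace R)
    (h : fcarrier X -> fcarrier Y) : Prop :=
  forall f, structure_functions Y f -> structure_functions X (f \o h).

Definition Phi (R : realType) (X : Type) (D0 : set (parametrization R X)) :
    set (X -> R) :=
  [set f : X -> R | forall p, D0 p -> smooth (f \o pfun p)].

Definition Pi (R : realType) (X : Type) (F0 : set (X -> R)) :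
    set (parametrization R X) :=
  [set p : parametrization R X | forall f, F0 f -> smooth (f \o pfun p)].

Definition reflexive_diffeology (R : realType) (X : diffeologicalSpace R) :
    Prop :=
  Pi (Phi (plots X)) = plots X.

Definition reflexive_differential (R : realType) (X : differentialSpace R) :
    Prop :=
  Phi (Pi (structure_functions X)) = structure_functions X.

Record category := Category {
  Obj : Type;
  Mor : Obj -> Obj -> Type;
  idmor : forall a, Mor a a;
  compm : forall a b c, Mor b c -> Mor a b -> Mor a c;
  compmA : forall a b c d (h : Mor c d) (g : Mor b c) (f : Mor a b),
    compm h (compm g f) = compm (compm h g) f;
  comp1m : forall a b (f : Mor a b), compm (idmor b) f = f;
  compm1 : forall a b (f : Mor a b), compm f (idmor a) = f
}.

Record functor (C D : category) := Functor {
  functor_obj : Obj C -> Obj D;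
  functor_map : forall a b : Obj C,
    Mor a b -> Mor (functor_obj a) (functor_obj b);
  functor_map1 : forall a, functor_map (idmor a) = idmor (functor_obj a);
  functor_mapM : forall a b c (g : Mor b c) (f : Mor a b),
    functor_map (compm g f) = compm (functor_map g) (functor_map f)
}.

Definition functor_id (C : category) : functor C C :=
  @Functor C C id (fun _ _ f => f) (fun=> erefl) (fun _ _ _ _ _ => erefl).

Section Composition.
Variables (C D E : category) (G : functor D E) (F : functor C D).

Let comp_map (a b : Obj C) (f : Mor a b) := functor_map G (functor_map F f).

Lemma functor_comp1 a :
  comp_map (idmor a) = idmor (functor_obj G (functor_obj F a)).
Proof. by rewrite /comp_map !functor_map1. Qed.

Lemma functor_compM a b c (g : Mor b c) (f : Mor a b) :
  comp_map (compm g f) = compm (comp_map g) (comp_map f).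
Proof. by rewrite /comp_map !functor_mapM. Qed.

Definition functor_comp : functor C E := Functor functor_comp1 functor_compM.
End Composition.

Definition inverse_functors (C D : category) (F : functor C D)
    (G : functor D C) : Prop :=
  functor_comp G F = functor_id C /\ functor_comp F G = functor_id D.

Definition full_subcategory (C : category) (P : Obj C -> Prop) : category :=
  @Category {a : Obj C | P a} (fun a b => Mor (sval a) (sval b))
    (fun a => idmor (sval a)) (fun _ _ _ g f => compm g f)
    (fun _ _ _ _ h g f => compmA h g f)
    (fun _ _ f => comp1m f) (fun _ _ f => compm1 f).

Definition inclusion_functor (C : category) (P : Obj C -> Prop) :
    functor (full_subcategory P) C :=
  @Functor (full_subcategory P) C sval (fun _ _ f => f)
    (fun=> erefl) (fun _ _ _ _ _ => erefl).

Definition sets : category :=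
  @Category Type (fun X Y => X -> Y) (fun X => id) (fun _ _ _ g f => g \o f)
    (fun _ _ _ _ _ _ _ => erefl) (fun _ _ _ => erefl) (fun _ _ _ => erefl).

Section DiffeologicalSpaces.
Variable R : realType.

Definition diffeo_hom (X Y : diffeologicalSpace R) :=
  {h : dcarrier X -> dcarrier Y | diffeologically_smooth h}.

Lemma diffeo_homP X Y (g h : diffeo_hom X Y) : sval g = sval h -> g = h.
Proof. by case: g h => [g ?] [h ?] /= gh; apply: eq_exist. Qed.

Lemma diffeo_id_subproof (X : diffeologicalSpace R) :
  diffeologically_smooth (@id (dcarrier X)).
Proof. by move=> [n U oU p]. Qed.

Definition diffeo_id X : diffeo_hom X X := exist _ id (@diffeo_id_subproof X).

Lemma diffeo_comp_subproof X Y Z (g : diffeo_hom Y Z) (f : diffeo_hom X Y) :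
  @diffeologically_smooth R X Z (sval g \o sval f).
Proof. by move=> p Xp; exact: (svalP g _ (svalP f _ Xp)). Qed.

Definition diffeo_comp X Y Z (g : diffeo_hom Y Z) (f : diffeo_hom X Y) :
    diffeo_hom X Z :=
  exist _ (sval g \o sval f) (diffeo_comp_subproof g f).

Lemma diffeo_compA X Y Z T (h : diffeo_hom Z T) (g : diffeo_hom Y Z)
    (f : diffeo_hom X Y) :
  diffeo_comp h (diffeo_comp g f) = diffeo_comp (diffeo_comp h g) f.
Proof. exact: diffeo_homP. Qed.

Lemma diffeo_comp1m X Y (f : diffeo_hom X Y) : diffeo_comp (diffeo_id Y) f = f.
Proof. exact: diffeo_homP. Qed.

Lemma diffeo_compm1 X Y (f : diffeo_hom X Y) : diffeo_comp f (diffeo_id X) = f.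
Proof. exact: diffeo_homP. Qed.

Definition diffeological_spaces : category :=
  Category diffeo_compA diffeo_comp1m diffeo_compm1.

Definition diffeo_forget : functor diffeological_spaces sets :=
  @Functor diffeological_spaces sets (@dcarrier R) (fun _ _ f => sval f)
    (fun=> erefl) (fun _ _ _ _ _ => erefl).

Definition reflexive_diffeological_spaces : category :=
  @full_subcategory diffeological_spaces (@reflexive_diffeology R).

Definition reflexive_diffeo_forget :
    functor reflexive_diffeological_spaces sets :=
  functor_comp diffeo_forget (inclusion_functor _).

End DiffeologicalSpaces.

Section DifferentialSpaces.
Variable R : realType.

Definition diffsp_hom (X Y : differentialSpace R) :=
  {h : fcarrier X -> fcarrier Y | functionally_smooth h}.

Lemma diffsp_homP X Y (g h : diffsp_hom X Y) : sval g = sval h -> g = h.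
Proof. by case: g h => [g ?] [h ?] /= gh; apply: eq_exist. Qed.

Lemma diffsp_id_subproof (X : differentialSpace R) :
  functionally_smooth (@id (fcarrier X)).
Proof. by []. Qed.

Definition diffsp_id X : diffsp_hom X X := exist _ id (@diffsp_id_subproof X).

Lemma diffsp_comp_subproof X Y Z (g : diffsp_hom Y Z) (f : diffsp_hom X Y) :
  @functionally_smooth R X Z (sval g \o sval f).
Proof. by move=> p Zp; exact: (svalP f _ (svalP g _ Zp)). Qed.

Definition diffsp_comp X Y Z (g : diffsp_hom Y Z) (f : diffsp_hom X Y) :
    diffsp_hom X Z :=
  exist _ (sval g \o sval f) (diffsp_comp_subproof g f).

Lemma diffsp_compA X Y Z T (h : diffsp_hom Z T) (g : diffsp_hom Y Z)
    (f : diffsp_hom X Y) :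
  diffsp_comp h (diffsp_comp g f) = diffsp_comp (diffsp_comp h g) f.
Proof. exact: diffsp_homP. Qed.

Lemma diffsp_comp1m X Y (f : diffsp_hom X Y) : diffsp_comp (diffsp_id Y) f = f.
Proof. exact: diffsp_homP. Qed.

Lemma diffsp_compm1 X Y (f : diffsp_hom X Y) : diffsp_comp f (diffsp_id X) = f.
Proof. exact: diffsp_homP. Qed.

Definition differential_spaces : category :=
  Category diffsp_compA diffsp_comp1m diffsp_compm1.

Definition diffsp_forget : functor differential_spaces sets :=
  @Functor differential_spaces sets (@fcarrier R) (fun _ _ f => sval f)
    (fun=> erefl) (fun _ _ _ _ _ => erefl).

Definition reflexive_differential_spaces : category :=
  @full_subcategory differential_spaces (@reflexive_differential R).

Definition reflexive_diffsp_forget :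
    functor reflexive_differential_spaces sets :=
  functor_comp diffsp_forget (inclusion_functor _).

End DifferentialSpaces.

(* Strict commutation with the forgetful functors to sets says that F is the
   identity on underlying sets and maps without transporting along equalities
   of carriers. *)
Definition is_Phi_functor (R : realType)
    (F : functor (reflexive_diffeological_spaces R)
                 (reflexive_differential_spaces R)) : Prop :=
  functor_comp (reflexive_diffsp_forget R) F = reflexive_diffeo_forget R /\
  forall X : Obj (reflexive_diffeological_spaces R),
    exists DX : is_differential_structure (Phi (plots (sval X))),
      sval (functor_obj F X) = DifferentialSpace DX.

Definition is_Pi_functor (R : realType)
    (G : functor (reflexive_differential_spaces R)
                 (reflexive_diffeological_spaces R)) : Prop :=
  functor_comp (reflexive_diffeo_forget R) G = reflexive_diffsp_forget R /\
  forall Y : Obj (reflexive_differential_spaces R),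
    exists FY : is_diffeology (Pi (structure_functions (sval Y))),
      sval (functor_obj G Y) = DiffeologicalSpace FY.

(* Main.v *)
Require Import Defs.
From mathcomp Require Import all_boot all_order all_algebra.
From mathcomp Require Import boolp classical_sets functions.
From mathcomp Require Import reals topology normedtype landau derive.

Set Implicit Arguments.
Unset Strict Implicit.
Unset Printing Implicit Defensive.

Import GRing.Theory Num.Theory.
Import numFieldNormedType.Exports.

Local Open Scope classical_set_scope.
Local Open Scope ring_scope.

(** [Phi] and [Pi] form an antitone Galois connection between sets of
    parametrizations and sets of functions: both express that [f \o p] is
    smooth for every [p] in the one and every [f] in the other.  On the
    reflexive objects they are therefore mutually inverse, by the very
    definition of reflexivity, and what has to be proved is that their values
    are structures of the right kind and that they act on morphisms.

    The former rests on calculus.  Closure of [Phi D] under composition with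
    a smooth function of several variables, and closure of [Pi F] under smooth
    reparametrization, are both the chain rule for smooth functions
    ([smooth_on_comp_row], [smooth_on_comp]); the constant maps and the locality
    axiom of [Pi F] are immediate because smoothness is local.  The locality
    axiom of [Phi D] refers to the topology generated by the functions
    themselves; there one needs that every plot is continuous for that
    topology ([functional_open_preimage]), which holds because the preimage of
    a generating open set under a plot [p] is a preimage under some continuous
    [f \o p].

    The action on morphisms is the identity on underlying maps: for a map [h],
    both notions of smoothness say that [f \o h \o p] is smooth, by bracketing
    the composition differently.  Hence the composites of the two functors
    agree with the identity functors after forgetting to sets, and they agree
    on objects by reflexivity.  As the forgetful functors are faithful, this
    yields equality of functors, without handling transported morphisms
    by hand ([faithful_functor_eq]). *)

(** * Calculus of C^k functions *)

Lemma near_eq_continuous (S T : topologicalType) (f g : S -> T) (x : S) :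
  (\near x, f x = g x) -> {for x, continuous f} -> {for x, continuous g}.
Proof.
move=> fg cf; rewrite /prop_for /continuous_at -(nbhs_singleton fg).
by apply: cvg_trans cf; exact: near_eq_cvg.
Qed.

(** The difference of the two functions vanishes near [a], so that the first
    order expansion of [f] at [a] is also one of [g]. *)
Lemma near_eq_differentiable (R : numFieldType) (V W : normedModType R)
    (f g : V -> W) (a : V) :
  (\near a, f a = g a) -> differentiable f a -> differentiable g a.
Proof.
move=> fg /diff_locallyP[dfc dfE].
suff dgE : g \o shift a = cst (g a) + 'd f a +o_ 0 id.
  by apply/diff_locallyP; rewrite (diff_unique dfc dgE).
apply/eqaddoP => e e0; move/eqaddoP : dfE => /(_ e e0).
apply: filterS2; last first.
  by move: fg; rewrite (near_shift 0) subr0; exact.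
by move=> h /= fgh; rewrite !fctE /= fgh (nbhs_singleton fg).
Qed.

Section Ck.
Variables (R : realType) (n : nat).
Implicit Types U V : set 'rV[R]_n.

(** The extension by zero used to define smoothness on a subset is only
    controlled on that subset; openness makes its germs there meaningful. *)
Lemma eq_Ck (W : normedModType R) k U (f g : 'rV[R]_n -> W) :
  open U -> {in U, f =1 g} -> Ck k U f -> Ck k U g.
Proof.
move=> oU.
have nfg (f' g' : 'rV[R]_n -> W) : {in U, f' =1 g'} ->
    forall x, U x -> \near x, f' x = g' x.
  by move=> fg x Ux; apply: (open_in_nearW oU fg); rewrite inE.
elim: k f g => [|k IHk] f g fg.
  by move=> cf x Ux; exact: near_eq_continuous (nfg _ _ fg x Ux) (cf x Ux).
move=> [df Df]; split=> [x Ux|i].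
  exact: near_eq_differentiable (nfg _ _ fg x Ux) (df x Ux).
apply: IHk (Df i) => x; rewrite inE => Ux.
exact: (near_eq_derive _ (nfg _ _ fg x Ux)).
Qed.

Lemma Ck_local (W : normedModType R) k U (f : 'rV[R]_n -> W) :
  (forall x, U x -> exists2 V, V x & Ck k V f) -> Ck k U f.
Proof.
elim: k f => [|k IHk] f locf /=.
  by move=> x /locf[V Vx]; exact.
split=> [x /locf[V Vx [df _]]|i]; first exact: df.
by apply: IHk => x /locf[V Vx [_ Df]]; exists V => //; exact: Df.
Qed.

Lemma CkW (W : normedModType R) k U (f : 'rV[R]_n -> W) :
  Ck k.+1 U f -> Ck k U f.
Proof.
elim: k f => [|k IHk] f [df Df].
  by move=> x Ux; apply/differentiable_continuous/df.
by split=> // i; apply/IHk/Df.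
Qed.

Lemma Ck_sub (W : normedModType R) k U V (f : 'rV[R]_n -> W) :
  V `<=` U -> Ck k U f -> Ck k V f.
Proof.
by move=> VU Uf; apply: Ck_local => x /VU Ux; exists U.
Qed.

Lemma Ck_cst (W : normedModType R) k U (c : W) : Ck k U (cst c).
Proof.
elim: k c => [|k IHk] c /=; first by move=> x _; exact: cst_continuous.
split=> [x _|i]; first exact: differentiable_cst.
by rewrite (_ : 'D_ _ _ = cst 0)//; apply/funext => x; rewrite derive_cst.
Qed.

Lemma CkD (W : normedModType R) k U (f g : 'rV[R]_n -> W) :
  open U -> Ck k U f -> Ck k U g -> Ck k U (f + g).
Proof.
move=> oU; elim: k f g => [|k IHk] f g /=.
  by move=> cf cg x Ux; apply: continuousD; [exact: cf|exact: cg].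
move=> [df Df] [dg Dg]; split=> [x Ux|i].
  by apply: differentiableD; [exact: df|exact: dg].
apply: eq_Ck (IHk _ _ (Df i) (Dg i)) => // x; rewrite inE => Ux.
by rewrite deriveD //; apply: diff_derivable; [exact: df|exact: dg].
Qed.

Lemma Ck_sum (W : normedModType R) k U m (f : 'I_m -> 'rV[R]_n -> W) :
  open U -> (forall i, Ck k U (f i)) -> Ck k U (\sum_i f i).
Proof.
move=> oU Cf; elim/big_ind: _ => //; first exact: Ck_cst.
by move=> g h; exact: CkD.
Qed.

(** The Leibniz rule also involves the functions themselves, hence the use of
    [CkW] to bring them down to the order of their derivatives. *)
Lemma CkM k U (f g : 'rV[R]_n -> R) :
  open U -> Ck k U f -> Ck k U g -> Ck k U (f * g).
Proof.
move=> oU; elim: k f g => [|k IHk] f g.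
  by move=> cf cg x Ux; exact: continuousM (cf x Ux) (cg x Ux).
move=> Cf Cg; have [df Df] := Cf; have [dg Dg] := Cg; split=> [x Ux|i].
  by apply: differentiableM; [exact: df|exact: dg].
apply: (@eq_Ck _ _ _ (f * 'D_(delta_mx 0 i) g + g * 'D_(delta_mx 0 i) f)) => //.
  move=> x; rewrite inE => Ux.
  by rewrite deriveM //; apply: diff_derivable; [exact: df|exact: dg].
exact: CkD oU (IHk _ _ (CkW Cf) (Dg i)) (IHk _ _ (CkW Cg) (Df i)).
Qed.

End Ck.

Section SmoothOn.
Variables (R : realType) (n : nat).
Implicit Types U : set 'rV[R]_n.

Lemma smooth_on_differentiable (W : normedModType R) U (f : 'rV[R]_n -> W) x :
  smooth_on U f -> U x -> differentiable f x.
Proof. by move=> /(_ 1%N)[+ _]; exact. Qed.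

Lemma smooth_on_partial (W : normedModType R) U (f : 'rV[R]_n -> W) i :
  smooth_on U f -> smooth_on U ('D_(delta_mx 0 i) f).
Proof. by move=> sf k; exact: (sf k.+1).2. Qed.

End SmoothOn.

Section Composition.
Variables (R : realType) (n : nat).
Implicit Types U : set 'rV[R]_n.

Lemma Ck_coord k U m (f : 'rV[R]_n -> 'rV[R]_m) (j : 'I_m) :
  open U -> smooth_on U f -> Ck k U (fun x => f x 0 j).
Proof.
move=> oU.
have dfj (h : 'rV[R]_n -> 'rV[R]_m) x : smooth_on U h -> U x ->
    differentiable (fun y => h y 0 j) x.
  move=> sh Ux.
  apply: (@differentiable_comp _ _ _ _ h (fun M : 'rV[R]_m => M 0 j)).
    exact: smooth_on_differentiable sh Ux.
  exact: differentiable_coord.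
elim: k f => [|k IHk] f sf; last split=> [x Ux|i].
- by move=> x Ux; apply: differentiable_continuous; exact: dfj.
- exact: dfj.
- apply: eq_Ck (IHk _ (smooth_on_partial i sf)) => // x; rewrite inE => Ux.
  rewrite derive_mx ?mxE//; apply: diff_derivable.
  exact: smooth_on_differentiable sf Ux.
Qed.

(** A row of functions is a linear combination of the fixed basis rows, with
    differentiable coefficients. *)
Lemma differentiable_row m (f : 'I_m -> 'rV[R]_n -> R) x :
  (forall j, differentiable (f j) x) ->
  differentiable (fun y => \row_j f j y) x.
Proof.
move=> df.
rewrite (_ : (fun y => _) = \sum_j (fun y => f j y *: delta_mx 0 j)).
  by apply: differentiable_sum => j; exact: differentiableZl.
apply/funext => y; rewrite fct_sumE [LHS]row_sum_delta.
by apply: eq_bigr => j _; rewrite mxE.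
Qed.

Lemma differentiable_comp_row m (f : 'I_m -> 'rV[R]_n -> R)
    (g : 'rV[R]_m -> R) x :
  (forall j, differentiable (f j) x) -> differentiable g (\row_j f j x) ->
  differentiable (fun y => g (\row_j f j y)) x.
Proof. by move=> /differentiable_row; exact: differentiable_comp. Qed.

(** The differential of [g] is linear, and its argument, the derivative of the
    inner row, is expanded in the standard basis. *)
Lemma derive_comp_row m (f : 'I_m -> 'rV[R]_n -> R) (g : 'rV[R]_m -> R) x v :
  (forall j, differentiable (f j) x) -> differentiable g (\row_j f j x) ->
  'D_v (fun y => g (\row_j f j y)) x =
    \sum_j 'D_v (f j) x * 'D_(delta_mx 0 j) g (\row_j f j x).
Proof.
move=> df dg; have drow := differentiable_row df.
have dgf := differentiable_comp drow dg.
rewrite (deriveE _ dgf) (diff_comp drow dg) /= -(deriveE _ drow).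
rewrite derive_mx; last exact: diff_derivable.
rewrite [X in 'd _ _ X]row_sum_delta linear_sum; apply: eq_bigr => j _.
rewrite linearZ -(deriveE _ dg) mxE.
by under eq_fun do rewrite mxE.
Qed.

(** Induction on the order, for all [g] at once: by the chain rule, each partial
    derivative of the composite is a sum of products of a partial derivative of
    some [f j] and the composite of a partial derivative of [g], and the latter
    is again smooth. *)
Lemma smooth_on_comp_row m U (T : set 'rV[R]_m) (f : 'I_m -> 'rV[R]_n -> R)
    (g : 'rV[R]_m -> R) :
  open U -> (forall x, U x -> T (\row_j f j x)) ->
  (forall j, smooth_on U (f j)) -> smooth_on T g ->
  smooth_on U (fun x => g (\row_j f j x)).
Proof.
move=> oU UT sf sg k.
have dsf x : U x -> forall j, differentiable (f j) x.
  by move=> Ux j; exact: smooth_on_differentiable Ux.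
elim: k g sg => [|k IHk] g sg.
  move=> x Ux; apply: differentiable_continuous.
  apply: differentiable_comp_row; first exact: dsf.
  exact: smooth_on_differentiable sg (UT x Ux).
split=> [x Ux|i].
  apply: differentiable_comp_row; first exact: dsf.
  exact: smooth_on_differentiable sg (UT x Ux).
pose Dg j x := 'D_(delta_mx 0 j) g (\row_j f j x).
apply: (@eq_Ck _ _ _ _ _ (\sum_j 'D_(delta_mx 0 i) (f j) * Dg j)) => //.
  move=> x; rewrite inE => Ux; rewrite fct_sumE derive_comp_row //.
    exact: dsf.
  exact: smooth_on_differentiable sg (UT x Ux).
apply: Ck_sum => // j; apply: CkM => //.
  exact: smooth_on_partial.
exact: IHk (smooth_on_partial j sg).
Qed.

Lemma smooth_on_comp m U (T : set 'rV[R]_m) (f : 'rV[R]_n -> 'rV[R]_m)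
    (g : 'rV[R]_m -> R) :
  open U -> (forall x, U x -> T (f x)) ->
  smooth_on U f -> smooth_on T g -> smooth_on U (g \o f).
Proof.
move=> oU UT sf sg.
have rowf x : f x = \row_j f x 0 j by apply/rowP => j; rewrite mxE.
rewrite (_ : g \o f = fun x => g (\row_j f x 0 j)); last first.
  by apply/funext => x /=; rewrite -rowf.
apply: smooth_on_comp_row sg => // [x Ux|j k]; last exact: Ck_coord.
by rewrite -rowf; exact: UT.
Qed.

End Composition.

(** * From diffeologies to differential structures and back *)

Section SmoothExtension.
Variables (R : realType) (n : nat).
Implicit Types U V : set 'rV[R]_n.

Lemma valL_set_val (T W : Type) (w : W) (A : set T) (g : A -> W) (u : A) :
  'valL_w g (val u) = g u.
Proof. by have := congr1 (@^~ u) (valLK w g). Qed.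

(** The values of an extension outside the open set [U] do not affect its germs
    at points of [U], so the extension by zero can be traded for any other;
    composites come with more convenient ones. *)
Lemma smoothP (W : normedModType R) U (g : U -> W) (f : 'rV[R]_n -> W) :
  open U -> (forall u, f (val u) = g u) -> smooth g <-> smooth_on U f.
Proof.
move=> oU fg.
have gf : {in U, 'valL_0 g =1 f}.
  by move=> x Ux; rewrite (valL_set_val _ _ (SigSub Ux)) -fg.
split=> sg k; apply: eq_Ck (sg k) => //.
by move=> x Ux; rewrite gf.
Qed.

Lemma smooth_cst (W : normedModType R) U (c : W) :
  open U -> smooth (fun _ : U => c).
Proof. by move=> oU; apply/(smoothP (f := cst c)) => // k; exact: Ck_cst. Qed.

(** The local model [h] lives on a subtype of its own, so it can be compared
    with [g] only through the underlying vectors. *)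
Lemma smooth_local (W : normedModType R) U (g : U -> W) :
  (forall u : U, exists V (h : V -> W),
     [/\ open V, V (val u), smooth h &
         forall (v : V), exists2 u' : U, val u' = val v & g u' = h v]) ->
  smooth g.
Proof.
move=> locg k; apply: Ck_local => x Ux.
have [V [h [oV Vx sh gh]]] := locg (SigSub (mem_set Ux)).
exists V => //; apply: eq_Ck (sh k) => // y Vy.
have [u' u'y gu'] := gh (SigSub Vy).
by rewrite (valL_set_val _ _ (SigSub Vy)) -gu' -(valL_set_val 0 g) u'y.
Qed.

End SmoothExtension.

Section PhiPi.
Variables (R : realType) (X : Type).

Definition param_preimage (p : parametrization R X) (A : set X) :
    set 'rV[R]_(pdim p) :=
  [set val u | u in pfun p @^-1` A].
Arguments param_preimage p A : clear implicits.

(** Plots are continuous for the topology generated by [F]: the sets with an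
    open preimage form a topology, and it contains the generators because
    each [f \o pfun p] is continuous. *)
Lemma functional_open_preimage (F : set (X -> R)) (p : parametrization R X) A :
  Pi F p -> functional_open F A -> open (param_preimage p A).
Proof.
move=> Fp.
suff : functional_open F `<=` [set B | open (param_preimage p B)] by exact.
apply: smallest_sub.
  split=> /=.
  - rewrite (_ : param_preimage p setT = pdom p); first exact: pdom_open.
    apply/seteqP; split=> [_ [u _ <-]|x px]; first exact/set_mem/valP.
    by exists (SigSub (mem_set px)).
  - move=> A1 A2 oA1 oA2.
    rewrite (_ : param_preimage p (A1 `&` A2) = param_preimage p A1 `&`
      param_preimage p A2); first exact: openI.
    apply/seteqP; split=> [_ [u [A1u A2u] <-]|x []]; first by split; exists u.
    move=> [u A1u <-] [u' A2u' /val_inj uu'].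
    by exists u => //; split=> //; rewrite -uu'.
  - move=> S oS; rewrite /param_preimage preimage_bigcup image_bigcup.
    by apply: bigcup_open => B /oS.
move=> _ [f [V [Ff oV ->]]] /=.
rewrite openE => _ [u Vu <-] /=.
have pu : pdom p (val u) := set_mem (valP u).
have cf := Fp f Ff 0%N (val u) pu.
have : nbhs (val u) ('valL_0 (f \o pfun p) @^-1` V).
  by apply: cf; apply: open_nbhs_nbhs; split=> //; rewrite valL_set_val.
have : nbhs (val u) (pdom p).
  by apply: open_nbhs_nbhs; split=> //; exact: pdom_open.
apply: filterS2 => y /mem_set py Vy; exists (SigSub py) => //.
by move: Vy; rewrite /preimage /mkset (valL_set_val _ _ (SigSub py)).
Qed.

(** Composing with a plot turns each axiom into a property of smooth functions
    on an open subset of a Euclidean space; in the locality axiom, the given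
    neighbourhoods in [X] pull back to open sets. *)
Lemma Phi_is_differential_structure (D : set (parametrization R X)) :
  inhabited X -> is_differential_structure (Phi D).
Proof.
move=> X0; split=> //.
- by exists (cst 0) => p _; apply: smooth_cst; exact: pdom_open.
- move=> k f G _ Df sG p Dp.
  apply/(smoothP (f := fun x => G (\row_i 'valL_0 (f i \o pfun p) x))).
  + exact: pdom_open.
  + move=> u /=; congr G; apply/rowP => i; rewrite !mxE.
    exact: valL_set_val.
  + apply: smooth_on_comp_row sG => //; first exact: pdom_open.
    by move=> i; exact: Df.
- move=> f locf p Dp; apply: smooth_local => u.
  have [A oA [Au [g Dg fg]]] := locf (pfun p u).
  have oV : open (param_preimage p A).
    by apply: functional_open_preimage oA => h; exact.
  have VU : param_preimage p A `<=` pdom p.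
    by move=> _ [v _ <-]; exact/set_mem/valP.
  exists (param_preimage p A), (g \o pfun p \o subset_incl VU).
  split => //; first by exists u.
    apply/(smoothP (f := 'valL_0 (g \o pfun p))) => //.
      by move=> v; rewrite (valL_set_val _ _ (subset_incl VU v)).
    by move=> k; apply: Ck_sub VU _; exact: Dg.
  move=> v; exists (subset_incl VU v) => //=; apply: fg.
  have [w Aw wv] := set_mem (valP v).
  by rewrite (_ : subset_incl VU v = w)//; exact/val_inj/esym.
Qed.

(** Composing with a function of [F] reduces locality and reparametrization of
    plots to locality of smoothness and the chain rule. *)
Lemma Pi_is_diffeology (F : set (X -> R)) :
  inhabited X -> is_diffeology (Pi F).
Proof.
move=> X0; split=> //.
- by move=> x n f _; exact: (@smooth_cst R n R setT (f x) openT).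
- move=> p locp f Ff; apply: smooth_local => u.
  have [V [oV [VU [Vu FV]]]] := locp (val u) (set_mem (valP u)).
  exists V, (f \o pfun p \o subset_incl VU); split=> //; first exact: FV.
  by move=> v; exists (subset_incl VU v).
- move=> p n V oV G Fp sG f Ff; pose vG v := val (G v).
  apply/(smoothP (f := 'valL_0 (f \o pfun p) \o 'valL_0 vG)) => //.
    by move=> v; rewrite /comp (valL_set_val 0 vG) valL_set_val.
  apply: smooth_on_comp sG (Fp f Ff) => // x Vx.
  rewrite (valL_set_val 0 vG (SigSub (mem_set Vx))).
  exact/set_mem/valP.
Qed.

End PhiPi.

(** * The isomorphism of categories *)

Section FunctorEquality.

Lemma functor_eq (C D : category) (F G : functor C D)
    (eFG : functor_obj F = functor_obj G) :
  (forall a b (f : Mor a b),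
     eq_rect _ (fun o : Obj C -> Obj D => Mor (o a) (o b)) (functor_map F f) _
       eFG = functor_map G f) ->
  F = G.
Proof.
case: F G eFG => [Fo Fm F1 FM] [Go Gm G1 GM] /= eFG.
case: Go / eFG Gm G1 GM => Gm G1 GM /= eFGm.
have eGm : Fm = Gm.
  by apply/functional_extensionality_dep => a;
     apply/functional_extensionality_dep => b; apply/funext => f; exact: eFGm.
case: Gm / eGm G1 GM {eFGm} => G1 GM.
by rewrite (Prop_irrelevance F1 G1) (Prop_irrelevance FM GM).
Qed.

(** Since proofs are irrelevant, the equality of object maps need not be the one
    induced by [F = G]; in particular it can be reflexivity whenever the object
    maps are convertible, and then no transport remains. *)
Lemma functor_map_eq (C D : category) (F G : functor C D)
    (eFG : functor_obj F = functor_obj G) : F = G ->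
  forall a b (f : Mor a b),
    eq_rect _ (fun o : Obj C -> Obj D => Mor (o a) (o b)) (functor_map F f) _
      eFG = functor_map G f.
Proof.
move=> FG; case: G / FG eFG => eFG a b f.
by rewrite (Prop_irrelevance eFG erefl).
Qed.

Lemma functor_compA (A B C D : category) (H : functor C D) (G : functor B C)
    (F : functor A B) :
  functor_comp (functor_comp H G) F = functor_comp H (functor_comp G F).
Proof.
by apply: (@functor_eq _ _ (functor_comp (functor_comp H G) F)
  (functor_comp H (functor_comp G F)) erefl).
Qed.

Lemma functor_compf1 (C D : category) (F : functor C D) :
  functor_comp F (functor_id C) = F.
Proof. by apply: (@functor_eq _ _ (functor_comp F (functor_id C)) F erefl). Qed.

Definition faithful (C D : category) (U : functor C D) :=
  forall a b (f g : Mor a b), functor_map U f = functor_map U g -> f = g.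

(** Once the object maps are identified, the images of a morphism under [F] and
    [G] are parallel, and [U] sends them to the same morphism. *)
Lemma faithful_functor_eq (C D E : category) (U : functor D E)
    (F G : functor C D) :
  faithful U -> functor_obj F =1 functor_obj G ->
  functor_comp U F = functor_comp U G -> F = G.
Proof.
move=> fU /funext eFG UFG; apply: (functor_eq (eFG := eFG)) => a b f; apply: fU.
case: F G eFG UFG => [Fo Fm F1 FM] [Go Gm G1 GM] /= eFG.
case: Go / eFG Gm G1 GM => Gm G1 GM UFG.
exact: (functor_map_eq (F := functor_comp U (Functor F1 FM))
  (G := functor_comp U (Functor G1 GM)) erefl UFG).
Qed.

End FunctorEquality.

Section Isomorphism.
Variable R : realType.

Definition Phi_space (X : diffeologicalSpace R) : differentialSpace R :=
  DifferentialSpace (Phi_is_differential_structure (plots X)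
    (diffeology_nonempty (plots_diffeology X))).

Definition Pi_space (Y : differentialSpace R) : diffeologicalSpace R :=
  DiffeologicalSpace (Pi_is_diffeology (structure_functions Y)
    (diffstruct_nonempty (functions_structure Y))).

(** Both here and in [Pi_smooth], the smoothness of [f \o h \o p] is read once
    with [h \o p] as a plot and once with [f \o h] as a function. *)
Lemma Phi_smooth (X Y : diffeologicalSpace R) (h : dcarrier X -> dcarrier Y) :
  diffeologically_smooth h ->
  @functionally_smooth R (Phi_space X) (Phi_space Y) h.
Proof. by move=> sh f Yf p Xp; exact: (Yf _ (sh p Xp)). Qed.

Lemma Pi_smooth (X Y : differentialSpace R) (h : fcarrier X -> fcarrier Y) :
  functionally_smooth h ->
  @diffeologically_smooth R (Pi_space X) (Pi_space Y) h.
Proof. by move=> sh p Xp f Yf; exact: (Xp _ (sh f Yf)). Qed.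

Lemma Phi_space_reflexive (X : diffeologicalSpace R) :
  reflexive_diffeology X -> reflexive_differential (Phi_space X).
Proof. by move=> rX; congr Phi. Qed.

Lemma Pi_space_reflexive (Y : differentialSpace R) :
  reflexive_differential Y -> reflexive_diffeology (Pi_space Y).
Proof. by move=> rY; congr Pi. Qed.

Lemma diffeologicalSpace_eq (X : Type) (D D' : set (parametrization R X))
    (dD : is_diffeology D) (dD' : is_diffeology D') :
  D = D' -> DiffeologicalSpace dD = DiffeologicalSpace dD'.
Proof.
by move=> eD; case: _ / eD dD' => dD'; rewrite (Prop_irrelevance dD dD').
Qed.

Lemma differentialSpace_eq (X : Type) (F F' : set (X -> R))
    (dF : is_differential_structure F) (dF' : is_differential_structure F') :
  F = F' -> DifferentialSpace dF = DifferentialSpace dF'.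
Proof.
by move=> eF; case: _ / eF dF' => dF'; rewrite (Prop_irrelevance dF dF').
Qed.

Lemma Phi_spaceK (X : diffeologicalSpace R) :
  reflexive_diffeology X -> Pi_space (Phi_space X) = X.
Proof. by case: X => X D dD rX; exact: diffeologicalSpace_eq. Qed.

Lemma Pi_spaceK (Y : differentialSpace R) :
  reflexive_differential Y -> Phi_space (Pi_space Y) = Y.
Proof. by case: Y => Y F dF rY; exact: differentialSpace_eq. Qed.

Definition Phi_obj (X : Obj (reflexive_diffeological_spaces R)) :
    Obj (reflexive_differential_spaces R) :=
  exist _ (Phi_space (sval X)) (Phi_space_reflexive (svalP X)).

Definition Pi_obj (Y : Obj (reflexive_differential_spaces R)) :
    Obj (reflexive_diffeological_spaces R) :=
  exist _ (Pi_space (sval Y)) (Pi_space_reflexive (svalP Y)).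

Definition Phi_map (X Y : Obj (reflexive_diffeological_spaces R))
    (h : Mor X Y) : Mor (Phi_obj X) (Phi_obj Y) :=
  exist _ (sval h) (Phi_smooth (svalP h)).

Definition Pi_map (X Y : Obj (reflexive_differential_spaces R))
    (h : Mor X Y) : Mor (Pi_obj X) (Pi_obj Y) :=
  exist _ (sval h) (Pi_smooth (svalP h)).

Lemma Phi_map1 (X : Obj (reflexive_diffeological_spaces R)) :
  Phi_map (idmor X) = idmor (Phi_obj X).
Proof. exact: diffsp_homP. Qed.

Lemma Phi_mapM (X Y Z : Obj (reflexive_diffeological_spaces R)) (g : Mor Y Z)
    (f : Mor X Y) :
  Phi_map (compm g f) = compm (Phi_map g) (Phi_map f).
Proof. exact: diffsp_homP. Qed.

Definition Phi_functor : functor (reflexive_diffeological_spaces R)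
                                 (reflexive_differential_spaces R) :=
  Functor Phi_map1 Phi_mapM.

Lemma Pi_map1 (Y : Obj (reflexive_differential_spaces R)) :
  Pi_map (idmor Y) = idmor (Pi_obj Y).
Proof. exact: diffeo_homP. Qed.

Lemma Pi_mapM (X Y Z : Obj (reflexive_differential_spaces R)) (g : Mor Y Z)
    (f : Mor X Y) :
  Pi_map (compm g f) = compm (Pi_map g) (Pi_map f).
Proof. exact: diffeo_homP. Qed.

Definition Pi_functor : functor (reflexive_differential_spaces R)
                                (reflexive_diffeological_spaces R) :=
  Functor Pi_map1 Pi_mapM.

Lemma Phi_functor_forget :
  functor_comp (reflexive_diffsp_forget R) Phi_functor =
  reflexive_diffeo_forget R.
Proof.
by apply: (@functor_eq _ _
  (functor_comp (reflexive_diffsp_forget R) Phi_functor)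
  (reflexive_diffeo_forget R) erefl).
Qed.

Lemma Pi_functor_forget :
  functor_comp (reflexive_diffeo_forget R) Pi_functor =
  reflexive_diffsp_forget R.
Proof.
by apply: (@functor_eq _ _
  (functor_comp (reflexive_diffeo_forget R) Pi_functor)
  (reflexive_diffsp_forget R) erefl).
Qed.

Lemma Phi_functorK :
  functor_comp Pi_functor Phi_functor =
  functor_id (reflexive_diffeological_spaces R).
Proof.
apply: (@faithful_functor_eq _ _ _ (reflexive_diffeo_forget R)).
- by move=> X Y f g; exact: diffeo_homP.
- move=> [X rX]; apply: eq_exist; exact: Phi_spaceK.
- by rewrite -functor_compA Pi_functor_forget Phi_functor_forget functor_compf1.
Qed.

Lemma Pi_functorK :
  functor_comp Phi_functor Pi_functor =
  functor_id (reflexive_differential_spaces R).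
Proof.
apply: (@faithful_functor_eq _ _ _ (reflexive_diffsp_forget R)).
- by move=> X Y f g; exact: diffsp_homP.
- move=> [Y rY]; apply: eq_exist; exact: Pi_spaceK.
- by rewrite -functor_compA Phi_functor_forget Pi_functor_forget functor_compf1.
Qed.

End Isomorphism.

Theorem theorem2p48 (R : realType) :
  exists (F : functor (reflexive_diffeological_spaces R)
                      (reflexive_differential_spaces R))
         (G : functor (reflexive_differential_spaces R)
                      (reflexive_diffeological_spaces R)),
    [/\ inverse_functors F G, is_Phi_functor F & is_Pi_functor G].
Proof.
exists (Phi_functor R), (Pi_functor R); split.
- by split; [exact: Phi_functorK|exact: Pi_functorK].
- split; [exact: Phi_functor_forget|move=> X].
  by exists (functions_structure (Phi_space (sval X))).
- split; [exact: Pi_functor_forget|move=> Y].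
  by exists (plots_diffeology (Pi_space (sval Y))).
Qed.
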